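(* There exists a dynamical system $(X,T)$, that is, a nonempty compact metric space $(X,d)$ together with a continuous surjective map $T:X\to X$, such that $(X,T)$ is Li-Yorke sensitive but is not Li-Yorke chaotic.
   Context: A dynamical system is a pair $(X,T)$ where $(X,d)$ is a compact metric space and $T:X\to X$ is a continuous surjective map. $T^n$ denotes the $n$-th iterate of $T$. A set $S\subseteq X$ is scrambled if for any two distinct points $x,y\in S$, $$\liminf_{n\to\infty} d(T^n(x),T^n(y))=0\quad\text{and}\quad \limsup_{n\to\infty} d(T^n(x),T^n(y))>0.$$ The system $(X,T)$ is Li-Yorke chaotic (chaotic in the sense of Li-Yorke) if there is an uncountable scrambled set $S\subseteq X$. The system $(X,T)$ is Li-Yorke sensitive if there is $\epsilon>0$ such that for every $x\in X$ and every neighbourhood $U$ of $x$ there is $y\in U$ with $$\liminf_{n\to\infty} d(T^n(x),T^n(y))=0\quad\text{and}\quad \limsup_{n\to\infty} d(T^n(x),T^n(y))>\epsilon.$$ *)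

(* Defs.v *)
From mathcomp Require Import all_boot all_order all_algebra.
From mathcomp Require Import all_classical all_reals all_analysis.

Set Implicit Arguments.
Unset Strict Implicit.
Unset Printing Implicit Defensive.

Import Order.TTheory GRing.Theory Num.Theory.
Import numFieldNormedType.Exports.

Local Open Scope classical_set_scope.
Local Open Scope ring_scope.

Definition dynamical_system (R : realType) (X : metricType R) (T : X -> X) :
    Prop :=
  [/\ compact [set: X], continuous T & set_surj [set: X] [set: X] T].

(* The lower and upper limits are taken in \bar R, where they exist without any
   boundedness side condition. *)
Definition orbit_liminf (R : realType) (X : metricType R) (T : X -> X)
    (x y : X) : \bar R :=
  limn_einf (fun n => (mdist (iter n T x) (iter n T y))%:E).

Definition orbit_limsup (R : realType) (X : metricType R) (T : X -> X)
    (x y : X) : \bar R :=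
  limn_esup (fun n => (mdist (iter n T x) (iter n T y))%:E).

Definition scrambled (R : realType) (X : metricType R) (T : X -> X)
    (S : set X) : Prop :=
  forall x y, S x -> S y -> x <> y ->
    orbit_liminf T x y = 0%E /\ (0 < orbit_limsup T x y)%E.

Definition li_yorke_chaotic (R : realType) (X : metricType R) (T : X -> X) :
    Prop :=
  exists S : set X, ~ countable S /\ scrambled T S.

Definition li_yorke_sensitive (R : realType) (X : metricType R) (T : X -> X) :
    Prop :=
  exists eps : R, 0 < eps /\
    forall (x : X) (U : set X), nbhs x U ->
      exists y, [/\ U y, orbit_liminf T x y = 0%E &
                    (eps%:E < orbit_limsup T x y)%E].

(* Main.v *)
Require Import Defs.
From HB Require Import structures.
From mathcomp Require Import all_boot all_order all_algebra.
From mathcomp Require Import all_classical all_reals all_analysis.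
From mathcomp Require Import zify.

(* The system is a subshift over the Cantor space of codes a : nat -> bool with
   a 0 = true.  The basic point of code a displays, on longer and longer time
   blocks, alternately a itself and an exceptional value: the e-th exceptional
   block carries a label (j, w), w a finite word, and shows the truncation
   cut j a if a starts with w, and a otherwise.  Every label occurs once.
   - If b = cut J a <> a with J > 0, the labels (J, w) with w a long prefix of a
     make a show exactly b while b shows itself, and the labels (0, w) make
     their 0-th bits differ, so (a, b) is a Li-Yorke pair at a fixed scale.
   - If a <> b have infinitely many 1s, a late label is either so long that
     at most one of them matches it, and then a 1 of the other one beyond the
     cut reveals the difference, or it cuts beyond their first difference:
     such points are never proximal.
   As blocks get longer, the remaining limit points are sequences with at most
   one jump, hence eventually constant; each is a limit of a single basic orbit,
   which yields its Li-Yorke partners.  Colouring points by their time delay and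
   by their code when it is finite leaves countably many colours without
   Li-Yorke pairs, so scrambled sets are countable. *)

Set Implicit Arguments.
Unset Strict Implicit.
Unset Printing Implicit Defensive.

Import Order.TTheory GRing.Theory Num.Theory.

Local Open Scope classical_set_scope.
Local Open Scope nat_scope.

(** * Codes, labels and displayed sequences *)

Definition code := nat -> bool.
Definition array := nat -> code.

Definition agree (N : nat) (x y : array) :=
  forall n i, n < N -> i < N -> x n i = y n i.

Definition later (n : nat) (x : array) : array := fun k => x (k + n).

Definition cut (j : nat) (a : code) : code := fun i => (i < j) && a i.

Definition label (e : nat) : option (nat * seq bool) := pickle_inv e.

Definition shown (e : nat) (a : code) : code :=
  if label e is Some (j, w) then
    if mkseq a (size w) == w :> seq bool then cut j a else a
  else a.

Definition display (a : code) (t : nat) : code :=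
  let q := trunc_log 2 t in if odd q then shown q./2 a else a.

(* The truncated subtraction makes n <= m' - m show the code itself: a delay of
   m' is a preimage under the shift, needed for surjectivity. *)
Definition wander (m m' : nat) (a : code) : array :=
  fun n => display a (n + m - m').

Definition jump (j k : nat) (d : bool) (a : code) : array :=
  fun n => if (n < k) == d then a else cut j a.

Lemma code_neq (a b : code) : a <> b -> exists i, a i <> b i.
Proof.
move=> ab; apply: contrapT => /forallNP h; apply: ab; apply/funext => i.
exact: contrapT (h i).
Qed.

Lemma agree_sym N x y : agree N x y -> agree N y x.
Proof. by move=> h n i nN iN; rewrite h. Qed.

Lemma agree_trans N x y z : agree N x y -> agree N y z -> agree N x z.
Proof. by move=> h h' n i nN iN; rewrite h ?h'. Qed.

Lemma agree_le N N' x y : N <= N' -> agree N' x y -> agree N x y.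
Proof. by move=> NN' h n i nN iN; rewrite h//; apply: leq_trans NN'. Qed.

Lemma display_even e a t : 2 ^ e.*2 <= t < 2 ^ e.*2.+1 -> display a t = a.
Proof. by move=> te; rewrite /display (trunc_log_eq _ te)// odd_double. Qed.

Lemma display_odd e a t : 2 ^ e.*2.+1 <= t < 2 ^ e.*2.+2 -> display a t = shown e a.
Proof.
by move=> te; rewrite /display (trunc_log_eq _ te)//= odd_double/= uphalf_double.
Qed.

Lemma display0 a : display a 0 = a.
Proof. by rewrite /display trunc_log0. Qed.

Lemma shown_match e a j l :
  label e = Some (j, mkseq a l) -> shown e a = cut j a.
Proof. by rewrite /shown => ->; rewrite size_mkseq eqxx. Qed.

Lemma shown_mismatch e a j w :
  label e = Some (j, w) -> mkseq a (size w) != w -> shown e a = a.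
Proof. by rewrite /shown => -> /negbTE ->. Qed.

Lemma mkseq_pre (a b : code) l :
  (forall i, i < l -> a i = b i) <-> mkseq a l = mkseq b l.
Proof.
split=> [ab|ab i il].
  by apply/eq_in_map => i; rewrite mem_iota => /andP[_]; exact: ab.
by rewrite -(nth_mkseq false a il) -(nth_mkseq false b il) ab.
Qed.

(** Pigeonhole: [B.+1] prefixes of distinct lengths, all at least [L], give distinct numbers, which
    cannot all lie below [B]. *)
Lemma label_often a j L B :
  exists l e, [/\ L <= l, B <= e & label e = Some (j, mkseq a l)].
Proof.
apply: contrapT => h.
have fB (l : 'I_B.+1) : pickle (j, mkseq a (l + L)) < B.
  rewrite ltnNge; apply/negP => Bl; apply: h.
  by exists (l + L), (pickle (j, mkseq a (l + L))); rewrite leq_addl /label pickleK_inv.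
have /leq_card : injective (fun l => Ordinal (fB l)).
  move=> l l' /(congr1 val)/= /(pcan_inj pickleK)[] /(congr1 size).
  by rewrite !size_mkseq => /addIn /val_inj.
by rewrite !card_ord ltnn.
Qed.

(** Only finitely many labels have both cut and word length at most [M]; [B] exceeds all their
    numbers. *)
Lemma label_long M : exists B, forall e j w, B <= e ->
  label e = Some (j, w) -> M < j \/ M < size w.
Proof.
pose F (p : 'I_M.+1 * M.-bseq bool) := (pickle (val p.1, val p.2)).+1.
exists (\max_p F p) => e j w Be ew.
have /= we := pickle_invK (T := (nat * seq bool)%type) e.
rewrite -[pickle_inv e]/(label e) ew /= in we.
have [?|jM] := ltnP M j; first by left.
right; rewrite ltnNge; apply/negP => wM.
have : F (Ordinal (jM : j < M.+1), Bseq wM) <= e.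
  exact: leq_trans (leq_bigmax _) Be.
by rewrite /F /= we ltnn.
Qed.

(** The time [n] is chosen before the code, so two points with the same delays show the block of the
    same label together. *)
Lemma visit_shown e m m' B N : B + m + N <= e -> exists2 n, B <= n &
  forall a k, k < N -> wander m m' a (k + n) = shown e a.
Proof.
move=> he; have lt := ltn_expl e.*2.+1 (isT : 1 < 2).
exists (2 ^ e.*2.+1 + m' - m) => [|a k kN]; first lia.
rewrite /wander; apply: display_odd; rewrite (expnS 2 e.*2.+1); lia.
Qed.

Lemma visit_code m m' B N : exists2 n, B <= n &
  forall a k, k < N -> wander m m' a (k + n) = a.
Proof.
set e := B + m + N; have lt := ltn_expl e.*2 (isT : 1 < 2).
exists (2 ^ e.*2 + m' - m) => [|a k kN]; first lia.
rewrite /wander; apply: (@display_even e); rewrite (expnS 2 e.*2); lia.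
Qed.

(** * Continuity in the code, and windows with one jump *)

Lemma display_local t N : exists L, forall a b : code,
  (forall i, i < L -> a i = b i) -> forall i, i < N -> display a t i = display b t i.
Proof.
rewrite /display /shown; case: odd => /=; last by exists N => a b ab i iN; rewrite ab.
case: label => [[j w]|]; last by exists N => a b ab i iN; rewrite ab.
exists (maxn N (size w)) => a b ab i iN.
rewrite (iffLR (mkseq_pre a b (size w))); last first.
  by move=> k kw; rewrite ab// leq_max kw orbT.
by case: eqP => _; rewrite /cut ab// leq_max iN.
Qed.

Lemma wander_local m m' N : exists L, forall a b : code,
  (forall i, i < L -> a i = b i) -> agree N (wander m m' a) (wander m m' b).
Proof.
suff hK : forall K, exists L, forall a b : code,
    (forall i, i < L -> a i = b i) ->
    forall n i, n < K -> i < N -> wander m m' a n i = wander m m' b n i.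
  by have [L hL] := hK N; exists L => a b /hL h n i; exact: h.
elim=> [|K [L hL]]; first by exists 0.
have [L' hL'] := display_local (K + m - m') N.
exists (maxn L L') => a b ab n i; rewrite ltnS leq_eqVlt => /predU1P[->|nK] iN.
  by apply: hL' => // k kL; rewrite ab// leq_max kL orbT.
by apply: hL => // k kL; rewrite ab// leq_max kL.
Qed.

Lemma shown_cut e a N : exists j, forall i, i < N -> shown e a i = cut j a i.
Proof.
rewrite /shown; case: label => [[j w]|]; last by exists N => i iN; rewrite /cut iN.
by case: eqP => _; [exists j|exists N => i iN; rewrite /cut iN].
Qed.

(** Blocks met from time [2 ^ N.+1] on are longer than [N], so the window crosses at most one
    boundary, and one of two adjacent blocks shows the code itself. *)
Lemma wander_jump N : exists K, forall m m' a,
  m' + K <= m \/ m + K <= m' ->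
  exists j k d, agree N (wander m m' a) (jump j k d a).
Proof.
exists (2 ^ N.+1) => m m' a [mm'|mm']; last first.
  (* Truncation keeps the time at 0; with [k = 0] and [d = false] the jump is constantly [a]. *)
  exists 0, 0, false => n i nN iN; rewrite /wander/jump/=.
  have := ltn_expl N.+1 (isT : 1 < 2) => ?.
  by rewrite (_ : n + m - m' = 0) ?display0//; lia.
have [t tE] : exists t, t = m - m' by exists (m - m').
have t0 : 0 < t by have := expn_gt0 2 N.+1; lia.
have /andP[qt tq] := trunc_log_bounds (isT : 1 < 2) t0.
have Nq : N < trunc_log 2 t.
  apply: trunc_log_max => //; lia.
move: (trunc_log 2 t) qt tq Nq => q qt tq Nq; have ltq := ltn_expl q (isT : 1 < 2).
(* [s] is the position of the next block boundary in the window. *)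
have [s sE] : exists s, s = 2 ^ q.+1 - t by exists (2 ^ q.+1 - t).
have wE n : n < N -> wander m m' a n = display a (n + t).
  by move=> nN; rewrite /wander tE; congr display; lia.
have eS := expnS 2 q; have eSS := expnS 2 q.+1.
have [qo|qe] := boolP (odd q).
- have qE : q = (q./2).*2.+1 by rewrite -[LHS]odd_double_half qo.
  have [j hj] := shown_cut q./2 a N.
  exists j, s, false => n i nN iN; rewrite wE// /jump.
  have [ns|ns] /= := ltnP n s.
    by rewrite (@display_odd q./2) ?hj// -qE; lia.
  rewrite (@display_even q./2.+1)// doubleS -qE; lia.
- have qE : q = (q./2).*2 by rewrite -[LHS]odd_double_half (negbTE qe).
  have [j hj] := shown_cut q./2 a N.
  exists j, s, true => n i nN iN; rewrite wE// /jump.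
  have [ns|ns] /= := ltnP n s.
    by rewrite (@display_even q./2)// -qE; lia.
  by rewrite (@display_odd q./2) ?hj// -qE; lia.
Qed.

(** A late block labelled by [j] and a prefix of [a] shows [cut j a] between two blocks showing [a];
    time [k] is aligned with its start if [d] holds, with its end otherwise. *)
Lemma jump_visited a j k d N B : exists2 m, B <= m &
  agree N (wander m 0 a) (jump j k d a).
Proof.
have [l [e [_ he el]]] := label_often a j 0 (B + k + N).
have := ltn_expl e.*2 (isT : 1 < 2) => lte.
have eS := expnS 2 e.*2; have eSS := expnS 2 e.*2.+1; have eSSS := expnS 2 e.*2.+2.
case: d.
- exists (2 ^ e.*2.+1 - k) => [|n i nN iN]; first lia.
  rewrite /wander subn0 /jump; have [nk|nk]/= := ltnP n k.
    rewrite (@display_even e)//; lia.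
  rewrite (@display_odd e) ?(shown_match el)//; lia.
- exists (2 ^ e.*2.+2 - k) => [|n i nN iN]; first lia.
  rewrite /wander subn0 /jump; have [nk|nk]/= := ltnP n k.
    rewrite (@display_odd e) ?(shown_match el)//; lia.
  rewrite (@display_even e.+1)// doubleS; lia.
Qed.

(* The parameters may depend on N: this covers j and k tending to infinity. *)
Definition limit_jump (a : code) (x : array) :=
  forall N, exists j k d, agree N x (jump j k d a).

(** A change of [x] after time [n] forces every large window to jump at [n.+1], which leaves no room
    for a later change. *)
Lemma limit_jump_stops x a : limit_jump a x ->
  exists k, forall n, k <= n -> x n = x k.
Proof.
move=> h; have [[n nn]|nj] := pselect (exists n, x n <> x n.+1); last first.
  exists 0 => n _; elim: n => // n <-; apply: contrapT => nn.
  by apply: nj; exists n => xn; exact: nn.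
have [i xi] := code_neq nn.
exists n.+1 => p np; apply/funext => i'.
have [j [k [d xs]]] := h (maxn p i + i').+2.
have sn q : jump j k d a q = if (q < k) == d then a else cut j a by [].
have kn : k = n.+1.
  have := xi; rewrite !xs ?sn; try lia.
  have [->//|] := eqVneq (n < k) (n.+1 < k).
  by have [|] := ltnP n k; have [|] := ltnP n.+1 k; lia.
rewrite !xs ?sn ?kn ?ltnn; try lia.
by rewrite ltnNge np.
Qed.

(** * Proximal and distal pairs *)

Definition proximal (x y : array) :=
  forall N B, exists2 n, B <= n & agree N (later n x) (later n y).

Definition apart (x y : array) :=
  forall B, exists2 n, B <= n & x n 0 != y n 0.

Lemma cut_proximal (a : code) J m m' : cut J a <> a ->
  proximal (wander m m' a) (wander m m' (cut J a)).
Proof.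
move=> aJ N B.
have [i ai] := code_neq aJ.
(* The word reaches beyond [i], where the codes differ, so it matches [a] but not [cut J a]. *)
have [l [e [il Be el]]] := label_often a J i.+1 (B + m + N).
have [n Bn hn] := visit_shown m' Be; exists n => // k c kN cN.
rewrite /later !hn// (shown_match el) (shown_mismatch el)//.
rewrite size_mkseq; apply/eqP => /mkseq_pre/(_ _ il); exact: ai.
Qed.

Lemma cut_apart (a : code) J m m' : 0 < J -> a 0 -> cut J a <> a ->
  apart (wander m m' a) (wander m m' (cut J a)).
Proof.
move=> J0 a0 aJ B.
have [i ai] := code_neq aJ.
have [l [e [il Be el]]] := label_often a 0 i.+1 (B + m + 1).
have [n Bn hn] := visit_shown m' Be; exists n => //.
rewrite -[n]add0n !hn// (shown_match el) (shown_mismatch el).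
  by rewrite /cut J0 a0.
rewrite size_mkseq; apply/eqP => /mkseq_pre/(_ _ il); exact: ai.
Qed.

Lemma wander_distal (a b : code) m m' : a <> b ->
  (forall K, exists2 i, K <= i & a i) -> (forall K, exists2 i, K <= i & b i) ->
  exists N B, forall n, B <= n ->
    exists2 i, i < N & wander m m' a n i != wander m m' b n i.
Proof.
move=> ab ainf binf.
have [M abM] := code_neq ab.
have [I MI aI] := ainf M; have [I' MI' bI'] := binf M.
have [B hB] := label_long M.
(* The window contains the difference at [M] and a later 1 of each code; from this time on,
   exceptional blocks have index at least [B]. *)
exists (maxn I I').+1, (2 ^ B.*2.+1 + m') => n Bn; rewrite /wander.
set t := n + m - m'; have tB : 2 ^ B.*2.+1 <= t by rewrite /t; lia.
have qB : B.*2.+1 <= trunc_log 2 t by exact: trunc_log_max.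
rewrite /display; case: ifP => _; last by exists M; [lia|exact/eqP].
have {}qB : B <= (trunc_log 2 t)./2 by lia.
move: (_./2) qB => e Be; rewrite /shown.
case ew : (label e) => [[j w]|]; last by exists M; [lia|exact/eqP].
have [Mj|jM] := ltnP M j.
  exists M; first lia.
  by case: ifP => _; case: ifP => _; rewrite /cut ?Mj/=; exact/eqP.
have Mw : M < size w by have [|//] := hB _ _ _ Be ew; lia.
(* Now [j <= M < size w]: the word cannot match both codes, and a code that matches shows only zeros
   from [M] on. *)
have [aw|aw] := eqVneq (mkseq a (size w)) w; last first.
  have [bw|bw] := eqVneq (mkseq b (size w)) w; last first.
    by exists M; [lia|exact/eqP].
  by exists I; [lia|rewrite aI /cut ltnNge (leq_trans jM MI)].
have [bw|bw] := eqVneq (mkseq b (size w)) w; last first.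
  by exists I'; [lia|rewrite bI' /cut ltnNge (leq_trans jM MI')].
by exfalso; apply: abM; apply: (iffRL (mkseq_pre a b (size w))) => //; rewrite aw.
Qed.

(** * The phase space and its metric *)

Definition carrier : set array := [set x |
  (exists m m' (a : code), a 0 /\ x = wander m m' a) \/
  (exists a : code, a 0 /\ limit_jump a x)].

Definition space (R : realType) := set_type carrier.

Section metric.
Variable R : realType.
Local Notation space := (space R).

Definition inv_first (P : pred nat) : R :=
  if pselect (exists N, P N) is left h then (ex_minn h).+1%:R^-1%R else 0%R.

(** As [agree 0] always holds, distances are at most [1/2], with equality exactly when the bits at
    [(0, 0)] differ. *)
Definition wdist (x y : array) : R := inv_first (fun N => ~~ `[< agree N x y >]).

Lemma wdist_lt N x y : (wdist x y < N.+1%:R^-1)%R <-> agree N x y.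
Proof.
rewrite /wdist /inv_first; case: pselect => [h|h]; last first.
  split=> _; last by rewrite invr_gt0 ltr0n.
  by apply: contrapT => /asboolPn nN; apply: h; exists N.
case: ex_minnP => K /asboolPn nK Kmin.
rewrite ltf_pV2 ?posrE ?ltr0n// ltr_nat ltnS; split=> [NK|aN].
  by apply: contrapT => /asboolPn /Kmin; rewrite leqNgt NK.
rewrite ltnNge; apply/negP => KN; exact: nK (agree_le KN aN).
Qed.

Lemma wdist_ge N x y : (N.+1%:R^-1 <= wdist x y)%R <-> ~ agree N x y.
Proof.
split=> [h xy|h]; first by have := iffRL (wdist_lt _ _ _) xy; rewrite ltNge h.
by rewrite leNgt; apply/negP => xy; apply/h/(iffLR (wdist_lt _ _ _) xy).
Qed.

Lemma wdist_ge0 x y : (0 <= wdist x y)%R.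
Proof. by rewrite /wdist /inv_first; case: pselect => // h; rewrite invr_ge0 ler0n. Qed.

Lemma wdist_eq0 x y : wdist x y = 0%R -> x = y.
Proof.
move=> xy; apply/funext => n; apply/funext => i.
have : (wdist x y < (maxn n i).+2%:R^-1)%R by rewrite xy invr_gt0 ltr0n.
by move=> /wdist_lt; apply; lia.
Qed.

Lemma wdistxx x : wdist x x = 0%R.
Proof.
by rewrite /wdist /inv_first; case: pselect => // h; exfalso; case: h => N /asboolPn; apply.
Qed.

Lemma wdist_sym x y : wdist x y = wdist y x.
Proof.
congr inv_first; apply/funext => N; congr (~~ _).
by apply: asbool_equiv_eq; split; exact: agree_sym.
Qed.

Lemma wdist_triangle y x z : (wdist x z <= wdist x y + wdist y z)%R.
Proof.
rewrite {1}/wdist /inv_first; case: pselect => [h|h]; last by rewrite addr_ge0// wdist_ge0.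
case: ex_minnP => K /asboolPn nK _.
have [/agree_trans xy|/wdist_ge xy] := pselect (agree K x y); last first.
  by rewrite (le_trans xy)// lerDl wdist_ge0.
have /wdist_ge yz : ~ agree K y z by move=> /xy.
by rewrite (le_trans yz)// lerDr wdist_ge0.
Qed.

HB.instance Definition _ := Choice.on space.
HB.instance Definition _ := isMetric.Build R space
  (fun x => wdistxx (val x)) (fun x y h => val_inj (wdist_eq0 h))
  (fun x y => wdist_sym (val x) (val y))
  (fun y x z => wdist_triangle (val y) (val x) (val z)).

Lemma nbhs_agree (x : space) (U : set space) :
  nbhs x U <-> exists N, forall y : space, agree N (val x) (val y) -> U y.
Proof.
split=> [/nbhs_ballP[e /= e0 eU]|[N NU]].
  have [N _ hN] := near_infty_natSinv_lt (PosNum e0).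
  exists N => y /wdist_lt xy; apply: eU; rewrite ballEmdist/=.
  by apply: lt_trans xy (hN N _); rewrite /=.
apply/nbhs_ballP; exists N.+1%:R^-1%R => /=; first by rewrite invr_gt0 ltr0n.
by move=> y; rewrite ballEmdist => /wdist_lt; exact: NU.
Qed.

End metric.

(** * Elementary bounds on upper and lower limits *)

Section limits.
Context {R : realType}.
Implicit Type u : (\bar R)^nat.
Local Open Scope ereal_scope.

Lemma le_limn_esup u c : (forall B, exists2 n, (B <= n)%N & c <= u n) ->
  c <= limn_esup u.
Proof.
move=> uc; apply: le_ereal_inf_tmp => _ [A [B _ BA] <-].
have [n Bn cn] := uc B; apply: le_trans cn (ereal_sup_ubound _).
by exists n => //; exact: BA.
Qed.

Lemma ge_limn_esup u c B : (forall n, (B <= n)%N -> u n <= c) ->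
  limn_esup u <= c.
Proof.
move=> uc; apply: (@le_trans _ _ (ereal_sup (u @` [set n | B <= n]%N))).
  by apply: ereal_inf_lbound; exists [set n | B <= n]%N => //; exists B.
by apply: ge_ereal_sup => _ [n Bn <-]; exact: uc.
Qed.

Lemma le_limn_einf u c B : (forall n, (B <= n)%N -> c <= u n) ->
  c <= limn_einf u.
Proof.
by move=> uc; rewrite /limn_einf leeNr; apply: (@ge_limn_esup _ _ B) => n /uc;
  rewrite leeN2.
Qed.

Lemma ge_limn_einf u c : (forall B, exists2 n, (B <= n)%N & u n <= c) ->
  limn_einf u <= c.
Proof.
move=> uc; rewrite /limn_einf leeNl; apply: le_limn_esup => B.
by have [n Bn un] := uc B; exists n => //; rewrite leeN2.
Qed.

End limits.

(** * The shift and its orbit distances *)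

Section dynamics.
Variable R : realType.
Local Notation space := (space R).

Lemma shiftX_carrier (x : space) : later 1 (val x) \in carrier.
Proof.
rewrite inE; have := set_valP x => -[[m [m' [a [a0 ->]]]]|[a [a0 ax]]].
  left; exists m.+1, m', a; split=> //; apply/funext => n.
  by rewrite /later /wander addn1 addSnnS.
right; exists a; split=> // N; have [j [k [d ak]]] := ax N.+1.
exists j, k.-1, d => n i nN iN; rewrite /later ak; try lia.
rewrite /jump; congr ((if _ == d then _ else _) i).
lia.
Qed.

Definition mkspace (x : array) (xP : x \in carrier) : space := exist _ x xP.

Definition shiftX (x : space) : space := mkspace (shiftX_carrier x).

Lemma iter_shiftX n x : val (iter n shiftX x) = later n (val x).
Proof.
elim: n => [|n IH]; first by apply/funext => k; rewrite /later addn0.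
by rewrite iterS /= IH; apply/funext => k; rewrite /later -addnA add1n.
Qed.

Lemma mdist_space (x y : space) : mdist x y = wdist R (val x) (val y).
Proof. by []. Qed.

Lemma liminf_proximal (x y : space) :
  proximal (val x) (val y) -> orbit_liminf shiftX x y = 0%E.
Proof.
move=> xy; apply/eqP; rewrite eq_le; apply/andP; split; last first.
  by apply: (@le_limn_einf _ _ _ 0) => n _; rewrite lee_fin mdist_ge0.
apply/lee_addgt0Pr => e e0; rewrite add0e.
have [N _ hN] := near_infty_natSinv_lt (PosNum e0).
apply: ge_limn_einf => B; have [n Bn xyn] := xy N B; exists n => //.
rewrite lee_fin mdist_space !iter_shiftX.
apply: ltW; apply: lt_trans (hN N _); last exact: leqnn.
exact/wdist_lt.
Qed.

Lemma limsup_apart (x y : space) :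
  apart (val x) (val y) -> (2^-1%:E <= orbit_limsup shiftX x y)%E.
Proof.
move=> xy; apply: le_limn_esup => B; have [n Bn xyn] := xy B; exists n => //.
rewrite lee_fin mdist_space !iter_shiftX; apply/wdist_ge => /(_ 0 0 isT isT).
exact/eqP.
Qed.

Lemma liminf_distal (x y : space) N B :
  (forall n, B <= n -> exists2 i, i < N & val x n i != val y n i) ->
  orbit_liminf shiftX x y <> 0%E.
Proof.
move=> xy xy0; have : (N.+1%:R^-1%:E <= orbit_liminf shiftX x y)%E.
  apply: (@le_limn_einf _ _ _ B) => n /xy[i iN xyi].
  rewrite lee_fin mdist_space !iter_shiftX; apply/wdist_ge => h.
  by move/eqP: xyi; apply; apply: (h 0 i) => //; exact: leq_ltn_trans iN.
by rewrite xy0 lee_fin leNgt invr_gt0 ltr0n.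
Qed.

Lemma limsup_asymptotic (x y : space) B :
  (forall n, B <= n -> val x n = val y n) -> (orbit_limsup shiftX x y <= 0)%E.
Proof.
move=> xy; apply: (@ge_limn_esup _ _ _ B) => n Bn.
rewrite lee_fin mdist_space !iter_shiftX.
rewrite (_ : later n (val y) = later n (val x)) ?wdistxx//.
by apply/funext => k; rewrite /later xy// (leq_trans Bn)// leq_addl.
Qed.

End dynamics.

(** * Continuity, surjectivity and compactness *)

Section system.
Variable R : realType.
Local Notation space := (space R).
Local Notation shiftX := (@shiftX R).

Lemma wander_carrier m m' (a : code) : a 0 -> wander m m' a \in carrier.
Proof. by move=> a0; rewrite inE; left; exists m, m', a. Qed.

Definition wanderer m m' (a : code) (a0 : a 0) : space :=
  mkspace R (wander_carrier m m' a0).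

Lemma shiftX_continuous : continuous shiftX.
Proof.
move=> x U /nbhs_agree[N NU]; apply/nbhs_agree; exists N.+1 => y xy.
by apply: NU => n i nN iN; rewrite /= /later xy//; lia.
Qed.

Lemma shiftX_surj : set_surj [set: space] [set: space] shiftX.
Proof.
move=> x _; have := set_valP x => -[[m [m' [a [a0 xa]]]]|[a [a0 ax]]].
  exists (wanderer m m'.+1 a0) => //; apply: val_inj; rewrite /= xa.
  by apply/funext => n; rewrite /later /wander; congr display; lia.
have yP : (fun n => val x n.-1) \in carrier.
  rewrite inE; right; exists a; split=> // N; have [j [k [d ak]]] := ax N.
  (* Repeating the first entry delays the jump by one, unless [k = 0], when that entry is already
     past it. *)
  exists j, (if k == 0 then 0 else k.+1), d => n i nN iN.
  rewrite ak; try lia.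
  by rewrite /jump; congr ((if _ == d then _ else _) i); case: (k) n {nN} => [|k'] [|n].
exists (mkspace R yP) => //; apply: val_inj => /=.
by apply/funext => n; rewrite /later addn1.
Qed.

Lemma space_compact : compact [set: space].
Proof.
rewrite compact_ultra => F FU _.
(* Boolean functions have limits along an ultrafilter; those of the entries form the candidate limit
   [b]. *)
pose ulim (P : space -> bool) : bool := `[< F [set x | P x] >].
have ulimE P : F [set x | P x = ulim P].
  rewrite /ulim; have [FP|FP] := in_ultra_setVsetC [set x | P x] FU.
    by apply: filterS (FP) => x /= ->; exact/esym/asboolP.
  apply: filterS (FP) => x /= /negP/negbTE ->; apply/esym/asboolPn => FP'.
  have [y [Py]] := filter_ex (filterI FP FP'); by apply: Py.
have ulims N (P : space -> nat -> bool) :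
    F [set x | forall i, i < N -> P x i = ulim (P^~ i)].
  elim: N => [|N IH]; first by apply: filterS (@filterT _ F _).
  apply: filterS (filterI IH (ulimE (P^~ N))) => x [/= h hN] i.
  by rewrite ltnS leq_eqVlt => /predU1P[->//|]; exact: h.
pose b : array := fun n i => ulim (fun x => val x n i).
have bE N : F [set x | agree N (val x) b].
  have bM M : F [set x | forall n i, n < M -> i < N -> val x n i = b n i].
    elim: M => [|M IH]; first by apply: filterS (@filterT _ F _).
    apply: filterS (filterI IH (ulims N (fun x => val x M))) => x [/= h hM] n i.
    by rewrite ltnS leq_eqVlt => /predU1P[->|]; [exact: hM|exact: h].
  exact: bM.
suff bP : b \in carrier.
  exists (mkspace R bP); split=> // U /nbhs_agree[N NU].
  by apply: filterS (bE N) => x xb; apply: NU; exact: agree_sym.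
pose W m m' : set space := [set x | exists a : code, a 0 /\ val x = wander m m' a].
rewrite inE; have [[m [m' FW]]|noW] := pselect (exists m m', F (W m m')).
  (* If the delays are fixed along [F], the limit code is read off at a time [n] when codes are
     displayed unchanged. *)
  have [n _ nE] := visit_code m m' 0 1; left; exists m, m', (b n); split.
    have [x [[a [a0 xa]] xb]] := filter_ex (filterI FW (bE n.+1)).
    by rewrite -xb// xa -[n]add0n nE.
  apply/funext => p; apply/funext => i.
  have [L hL] := wander_local m m' (maxn p i).+1.
  have [x [[a [a0 xa]] xb]] := filter_ex (filterI FW (bE (maxn (maxn p i) (maxn n L)).+1)).
  rewrite -xb ?xa; try lia.
  apply: hL; try lia.
  move=> k kL; rewrite -xb ?xa; try lia.
  by rewrite -[n]add0n nE.
(* Otherwise [F] avoids each fixed delay, so the points look like jumps of their codes [p x], and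
   [b] like jumps of the limit code. *)
have pE (x : space) : exists a : code, a 0 /\
    ((exists m m', val x = wander m m' a) \/ limit_jump a (val x)).
  by have := set_valP x => -[[m [m' [a [a0 xa]]]]|[a [a0 ax]]]; exists a; split=> //;
    [left; exists m, m'|right].
pose p x := sval (cid (pE x)).
have p0 x : p x 0 by rewrite /p; case: cid => a [].
have pP x : (exists m m', val x = wander m m' (p x)) \/ limit_jump (p x) (val x).
  by rewrite /p; case: cid => a [].
pose a : code := fun i => ulim (fun x => p x i).
right; exists a; split.
  by have [x xE] := filter_ex (ulimE (fun x => p x 0)); rewrite /a -xE; exact: p0.
move=> N; have [K hK] := wander_jump N.
have FK : F [set x | forall m, m < K -> ~ W m 0 x /\ ~ W 0 m x].
  elim: (K) => [|M IH]; first by apply: filterS (@filterT _ F _).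
  have noW' m m' : F (~` W m m').
    have [FW|//] := in_ultra_setVsetC (W m m') FU.
    by exfalso; apply: noW; exists m, m'.
  apply: filterS (filterI IH (filterI (noW' M 0) (noW' 0 M))) => x [/= h hM] m.
  by rewrite ltnS leq_eqVlt => /predU1P[->//|]; exact: h.
have [x [[xa xb] xK]] := filter_ex (filterI (filterI (ulims N p) (bE N)) FK).
suff [j [k [d xs]]] : exists j k d, agree N (val x) (jump j k d (p x)).
  exists j, k, d => n i nN iN; rewrite -xb// xs//.
  by rewrite /jump; case: ifP => _; rewrite /cut xa.
have [[m [m' xm]]|] := pP x; last exact.
(* Only the truncated differences of the delays matter, so finitely many sets [W] cover all small
   delays. *)
have xW : W (m - m') (m' - m) x.
  by exists (p x); split=> //; rewrite xm; apply/funext => n; rewrite /wander; congr display; lia.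
rewrite xm; apply: hK; apply: contrapT => mm'.
have [le|le] := leqP m' m.
  have [|+ _] := xK (m - m') _; first lia.
  by apply; have <- : m' - m = 0 by lia.
have [|_] := xK (m' - m) _; first lia.
by apply; have <- : m - m' = 0 by lia.
Qed.

Lemma space_dynamical : dynamical_system shiftX.
Proof.
by split; [exact: space_compact|exact: shiftX_continuous|exact: shiftX_surj].
Qed.

(** * Li-Yorke sensitivity *)

Lemma proximal_sym (x y : array) : proximal x y -> proximal y x.
Proof.
by move=> xy N B; have [n Bn h] := xy N B; exists n => //; exact: agree_sym.
Qed.

Lemma apart_sym (x y : array) : apart x y -> apart y x.
Proof.
by move=> xy B; have [n Bn h] := xy B; exists n => //; rewrite eq_sym.
Qed.

Lemma space_sensitive : li_yorke_sensitive shiftX.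
Proof.
exists (4^-1)%R; split; first by rewrite invr_gt0 ltr0n.
move=> x U /nbhs_agree[N NU].
suff [y [xy pxy sxy]] : exists y : space,
    [/\ agree N (val x) (val y), proximal (val x) (val y) & apart (val x) (val y)].
  exists y; split; [exact: NU|exact: liminf_proximal|].
  apply: lt_le_trans (limsup_apart sxy); rewrite lte_fin.
  by rewrite ltf_pV2 ?posrE ?ltr0n// ltr_nat.
have := set_valP x => -[[m [m' [a [a0 xa]]]]|[a [a0 ax]]]; last first.
  have [k xk] := limit_jump_stops ax.
  have [j [k' [d xs]]] := ax N.
  (* The partner is the basic orbit of [a], entered at a moment when it looks like [x]. *)
  have [m _ ms] := jump_visited a j k' d N 0.
  exists (wanderer m 0 a0); split => /=; first exact: agree_trans xs (agree_sym ms).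
  (* The last [M] times of this window show the constant tail of [x], and the basic orbit shows the
     window arbitrarily late. *)
  - move=> M B; have [j' [l [d' xs']]] := ax (M + k).
    have [m2 Bm2 ms'] := jump_visited a j' l d' (M + k) (B + m).
    exists (m2 + k - m) => [|n i nM iM]; first lia.
    rewrite /later xk; last lia.
    rewrite -(xk (n + k)) ?leq_addl// xs'; try lia.
    by rewrite -ms'; [|lia|lia]; rewrite /wander; congr display; lia.
  (* The partner's bit 0 is false on blocks cut at 0 and true whenever [a] is shown; one of these
     differs from the tail of [x]. *)
  - move=> B; have [xk0|xk0] := boolP (val x k 0).
      have [l [e [_ Be el]]] := label_often a 0 0 (B + k + m + 1).
      have [n Bn nE] := visit_shown (B := B + k) (m := m) 0 Be.
      exists n; first lia.
      rewrite xk ?xk0; last lia.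
      by rewrite -[n]add0n nE// (shown_match el).
    have [n Bn nE] := visit_code m 0 (B + k) 1; exists n; first lia.
    rewrite xk; last lia.
    by rewrite -[n]add0n nE// (negbTE xk0) a0.
have [L hL] := wander_local m m' N.
have cut0 (c : code) : c 0 -> cut L.+1 c 0 by rewrite /cut.
have cutL (c : code) i : i < L -> c i = cut L.+1 c i.
  by move=> iL; rewrite /cut (ltn_trans iL).
(* Either [a] has a proper truncation as partner, or it is one itself, of [a] with a 1 added at
   [L.+1]. Cutting at [L.+1] keeps bit 0 even if [L = 0]. *)
have [aL|aL] := pselect (cut L.+1 a = a); last first.
  exists (wanderer m m' (cut0 _ a0)); rewrite xa /=; split.
  - by apply: hL; exact: cutL.
  - exact: cut_proximal.
  - exact: cut_apart.
pose c : code := fun i => (i == L.+1) || a i.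
have c0 : c 0 by rewrite /c.
have cE : cut L.+1 c = a.
  rewrite -[RHS]aL; apply/funext => i; rewrite /cut /c.
  by case: ltnP => // iL; rewrite (ltn_eqF iL).
have ca : cut L.+1 c <> c.
  by move=> /(congr1 (@^~ L.+1)); rewrite /cut /c ltnn eqxx.
exists (wanderer m m' c0); rewrite xa /= -{1 2 3}cE; split.
- by apply: agree_sym; apply: hL; exact: cutL.
- exact/proximal_sym/cut_proximal.
- exact/apart_sym/cut_apart.
Qed.

(** * Countable colouring without Li-Yorke pairs *)

Definition colour_class (c : option (nat * nat * option (seq bool))) : set array :=
  match c with
  | None => [set x | exists k, forall n, k <= n -> x n = x k]
  | Some (m, m', None) =>
    [set x | exists2 a : code, (forall K, exists2 i, K <= i & a i) & x = wander m m' a]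
  | Some (m, m', Some w) => [set wander m m' (nth false w)]
  end.

Lemma colour_exists (x : space) : exists c, colour_class c (val x).
Proof.
have := set_valP x => -[[m [m' [a [a0 xa]]]]|[a [a0 ax]]]; last first.
  by exists None; exact: limit_jump_stops ax.
have [ainf|] := pselect (forall K, exists2 i, K <= i & a i).
  by exists (Some (m, m', None)); exists a.
move=> /existsNP[K aK]; exists (Some (m, m', Some (mkseq a K))) => /=.
rewrite xa; congr wander; apply/funext => i.
have [iK|Ki] := ltnP i K; first by rewrite nth_mkseq.
rewrite nth_default ?size_mkseq//; apply/negP => ai.
by apply: aK; exists i.
Qed.

(** A class with a finite code is a singleton, infinite codes with common delays are distal, and
    eventually constant points are asymptotic or stay a positive distance apart. *)
Lemma colour_not_scrambled c (x y : space) : x <> y ->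
  colour_class c (val x) -> colour_class c (val y) ->
  ~ (orbit_liminf shiftX x y = 0%E /\ (0 < orbit_limsup shiftX x y)%E).
Proof.
move=> xy; case: c => [[[m m'] [w|]]|].
- by move=> xw yw; case: xy; apply: val_inj; exact: etrans xw (esym yw).
- move=> [a ainf xa] [b binf yb] [+ _].
  have ab : a <> b by move=> ab; apply/xy/val_inj; rewrite ab in xa; exact: etrans xa (esym yb).
  have [N [B h]] := @wander_distal a b m m' ab ainf binf.
  by apply: (@liminf_distal _ _ _ N B) => n /h; rewrite xa yb.
move=> [k xk] [l yl] [inf0 sup0].
have [kl|/code_neq[i kli]] := pselect (val x k = val y l).
  suff : (orbit_limsup shiftX x y <= 0)%E by rewrite leNgt sup0.
  by apply: (@limsup_asymptotic _ _ _ (k + l)) => n kln; rewrite xk ?yl//; lia.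
apply: (@liminf_distal _ x y i.+1 (k + l)) inf0 => n kln; exists i => //.
by rewrite xk ?yl; [exact/eqP|lia|lia].
Qed.

Lemma space_not_chaotic : ~ li_yorke_chaotic shiftX.
Proof.
move=> [S [+ scrS]]; apply.
pose colour x := sval (cid (colour_exists x)).
have colourP x : colour_class (colour x) (val x) by rewrite /colour; case: cid.
(* Colours are countable, and a scrambled set has at most one point of each. *)
apply/countable_injP; exists (pickle \o colour) => x y /set_mem Sx /set_mem Sy.
move=> /(pcan_inj pickleK) xy; apply: contrapT => neq.
apply: (@colour_not_scrambled (colour x) x y neq (colourP x)); first by rewrite xy.
exact: scrS.
Qed.

End system.

Theorem theorem1 (R : realType) :
  exists (X : metricType R) (T : X -> X),
    [/\ [set: X] !=set0, dynamical_system T, li_yorke_sensitive T &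
        ~ li_yorke_chaotic T].
Proof.
exists (space R), (@shiftX R); split.
- by exists (@wanderer R 0 0 xpredT isT).
- exact: space_dynamical.
- exact: space_sensitive.
- exact: space_not_chaotic.
Qed.
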